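(* The pair $(c_0,c_0)$ does not have the Compact Perturbation Property for the minimum modulus (CPPm). That is, it is not the case that every bounded linear operator $T:c_0\to c_0$ which does not attain its minimum modulus satisfies $\sup_{K\in\mathcal{K}(c_0,c_0)} m(T+K)=m(T)$.
   Context: Scalars are $\mathbb{K}=\mathbb{R}$ or $\mathbb{C}$. $c_0$ is the Banach space of scalar sequences converging to $0$, with the supremum norm. For Banach spaces $X,Y$ over $\mathbb{K}$, $L(X,Y)$ denotes the space of bounded linear operators from $X$ to $Y$, $\mathcal{K}(X,Y)$ the space of compact linear operators from $X$ to $Y$, and $S_X=\{x\in X:\|x\|=1\}$ the unit sphere of $X$. The minimum modulus of $T\in L(X,Y)$ is $m(T)=\inf\{\|Tx\|:x\in S_X\}$. The operator $T$ attains its minimum modulus if there is $x\in S_X$ with $\|Tx\|=m(T)$. The pair $(X,Y)$ has the Compact Perturbation Property for the minimum modulus (CPPm) if for every $T\in L(X,Y)$ that does not attain its minimum modulus one has $\sup_{K\in\mathcal{K}(X,Y)} m(T+K)=m(T)$. *)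

(* Defs.v *)
From Stdlib Require Import Reals Lra Lia List ClassicalEpsilon.
From Stdlib Require Import FunctionalExtensionality PropExtensionality.
From Stdlib Require Import ProofIrrelevance.
From Coquelicot Require Import Coquelicot.

Open Scope R_scope.

(* Null sequences in a Banach space V over K; the scalar space c_0 is the case
   where V is K = R or K = C, seen as a Banach space over itself. *)

Record null_seq {K : AbsRing} (V : CompleteNormedModule K) : Type := Null_seq
  { null_val :> nat -> V;
    null_lim : filterlim null_val eventually (locally (zero : V)) }.

Arguments Null_seq {K V} _ _.
Arguments null_val {K V} _ _.
Arguments null_lim {K V} _.

Section C0.

Context {K : AbsRing} {V : CompleteNormedModule K}.

Implicit Types x y z : null_seq V.

Lemma null_seq_ext x y : (forall n, x n = y n) -> x = y.
Proof.
destruct x as [x px], y as [y py]; simpl; intros H.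
assert (E : x = y) by (apply functional_extensionality; exact H).
subst y; f_equal; apply proof_irrelevance.
Qed.

Lemma null_limP (u : nat -> V) :
  filterlim u eventually (locally (zero : V)) <->
  forall eps : posreal, eventually (fun n => norm (u n) < eps).
Proof.
split; intros H.
- intros eps. apply (H (fun v => norm v < eps)).
  apply (locally_le_locally_norm (zero : V)). exists eps. intros v Hv.
  now rewrite <- (minus_zero_r v).
- intros P HP. apply (locally_norm_le_locally (zero : V)) in HP.
  destruct HP as [eps HP]. unfold filtermap.
  apply (filter_imp (fun n => norm (u n) < eps)); [|apply H].
  intros n Hn. apply HP. apply Rle_lt_trans with (2 := Hn).
  right; f_equal; apply (minus_zero_r (u n)).
Qed.

Definition c0_zero : null_seq V :=
  Null_seq (fun _ => zero) (filterlim_const (zero : V)).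

Lemma c0_plus_lim x y :
  filterlim (fun n => plus (x n) (y n)) eventually (locally (zero : V)).
Proof.
rewrite <- (plus_zero_l (zero : V)).
eapply filterlim_comp_2; [apply null_lim | apply null_lim | apply (filterlim_plus (V := V))].
Qed.

Definition c0_plus x y : null_seq V :=
  Null_seq (fun n => plus (x n) (y n)) (c0_plus_lim x y).

Lemma c0_opp_lim x : filterlim (fun n => opp (x n)) eventually (locally (zero : V)).
Proof.
replace (zero : V) with (opp (zero : V)) by apply (opp_zero (G := V)).
eapply filterlim_comp; [apply null_lim | apply (filterlim_opp (V := V))].
Qed.

Definition c0_opp x : null_seq V :=
  Null_seq (fun n => opp (x n)) (c0_opp_lim x).

Lemma c0_scal_lim (k : K) x :
  filterlim (fun n => scal k (x n)) eventually (locally (zero : V)).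
Proof.
replace (zero : V) with (scal k (zero : V)) by apply (scal_zero_r (V := V)).
eapply filterlim_comp; [apply null_lim | apply (filterlim_scal_r (V := V))].
Qed.

Definition c0_scal (k : K) x : null_seq V :=
  Null_seq (fun n => scal k (x n)) (c0_scal_lim k x).

Definition c0_AbelianMonoid_mixin : AbelianMonoid.mixin_of (null_seq V).
Proof.
apply (AbelianMonoid.Mixin _ c0_plus c0_zero);
  intros; apply null_seq_ext; intros n; simpl.
- apply plus_comm.
- apply plus_assoc.
- apply plus_zero_r.
Defined.

Canonical c0_AbelianMonoid :=
  AbelianMonoid.Pack (null_seq V) c0_AbelianMonoid_mixin (null_seq V).

Definition c0_AbelianGroup_mixin : AbelianGroup.mixin_of c0_AbelianMonoid.
Proof.
apply (AbelianGroup.Mixin c0_AbelianMonoid c0_opp).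
intros x; apply null_seq_ext; intros n; exact (plus_opp_r (x n : V)).
Defined.

Canonical c0_AbelianGroup :=
  AbelianGroup.Pack (null_seq V)
    (AbelianGroup.Class _ c0_AbelianMonoid_mixin c0_AbelianGroup_mixin)
    (null_seq V).

Definition c0_ModuleSpace_mixin : ModuleSpace.mixin_of K c0_AbelianGroup.
Proof.
apply (ModuleSpace.Mixin K c0_AbelianGroup c0_scal);
  intros; apply null_seq_ext; intros n; simpl.
- apply scal_assoc.
- apply (scal_one (V := V)).
- apply (scal_distr_l (V := V)).
- apply (scal_distr_r (V := V)).
Defined.

Canonical c0_ModuleSpace :=
  ModuleSpace.Pack K (null_seq V)
    (ModuleSpace.Class K _ (AbelianGroup.class c0_AbelianGroup)
       c0_ModuleSpace_mixin)
    (null_seq V).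

Definition c0_norm x : R := real (Sup_seq (fun n => Finite (norm (x n)))).

Lemma null_bounded x : exists M, forall n, norm (x n) <= M.
Proof.
destruct (proj1 (null_limP x) (null_lim x) (mkposreal 1 Rlt_0_1)) as [N HN].
assert (H : exists M, forall n, (n < N)%nat -> norm (x n) <= M).
{ clear HN; induction N as [|N [M HM]].
  - exists 0; intros n Hn; lia.
  - exists (Rmax M (norm (x N))); intros n Hn.
    destruct (Nat.eq_dec n N) as [-> | ne]; [apply Rmax_r|].
    eapply Rle_trans; [apply HM; lia | apply Rmax_l]. }
destruct H as [M HM]; exists (Rmax M 1); intros n.
destruct (Nat.lt_ge_cases n N) as [lt | ge].
- eapply Rle_trans; [apply HM, lt | apply Rmax_l].
- eapply Rle_trans; [apply Rlt_le, HN, ge | apply Rmax_r].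
Qed.

Lemma c0_norm_finite x :
  Sup_seq (fun n => Finite (norm (x n))) = Finite (c0_norm x).
Proof.
destruct (null_bounded x) as [M HM].
unfold c0_norm; generalize (Sup_seq_correct (fun n => Finite (norm (x n)))).
destruct (Sup_seq _) as [s | |]; intros H; [reflexivity | exfalso | exfalso].
- destruct (H M) as [n Hn]; simpl in Hn; specialize (HM n); lra.
- specialize (H 0 0%nat); simpl in H; generalize (norm_ge_0 (x 0%nat)); lra.
Qed.

Lemma c0_norm_ub x n : norm (x n) <= c0_norm x.
Proof.
generalize (Sup_seq_correct (fun n => Finite (norm (x n)))).
rewrite c0_norm_finite; intros Hs.
apply le_epsilon; intros e He.
apply Rlt_le, (proj1 (Hs (mkposreal e He)) n).
Qed.

Lemma c0_norm_lub x M : (forall n, norm (x n) <= M) -> c0_norm x <= M.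
Proof.
intros H.
generalize (Sup_seq_correct (fun n => Finite (norm (x n)))).
rewrite c0_norm_finite; intros Hs.
apply le_epsilon; intros e He.
destruct (proj2 (Hs (mkposreal e He))) as [n Hn]; simpl in Hn.
specialize (H n); lra.
Qed.

Lemma c0_norm_triangle x y : c0_norm (plus x y) <= c0_norm x + c0_norm y.
Proof.
apply c0_norm_lub; intros n.
eapply Rle_trans; [apply (norm_triangle (x n) (y n))|].
apply Rplus_le_compat; apply c0_norm_ub.
Qed.

Lemma c0_norm_scal (k : K) x : c0_norm (scal k x) <= abs k * c0_norm x.
Proof.
apply c0_norm_lub; intros n.
eapply Rle_trans; [apply (norm_scal k (x n))|].
apply Rmult_le_compat_l; [apply abs_ge_0 | apply c0_norm_ub].
Qed.

Lemma c0_norm_eq_zero x : c0_norm x = 0 -> x = zero.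
Proof.
intros H; apply null_seq_ext; intros n; apply (norm_eq_zero (x n)).
apply Rle_antisym; [rewrite <- H; apply c0_norm_ub | apply norm_ge_0].
Qed.

Lemma c0_norm_minus_sym x y : c0_norm (minus x y) = c0_norm (minus y x).
Proof.
unfold c0_norm; f_equal; apply Sup_seq_ext; intros n; f_equal.
change (norm (minus (x n) (y n)) = norm (minus (y n) (x n))).
exact (eq_trans (eq_sym (norm_opp _)) (f_equal norm (opp_minus (x n) (y n)))).
Qed.

Definition c0_ball x (e : R) y : Prop := c0_norm (minus y x) < e.

Definition c0_UniformSpace_mixin : UniformSpace.mixin_of (null_seq V).
Proof.
apply (UniformSpace.Mixin _ c0_zero c0_ball); unfold c0_ball.
- intros x [e He]; simpl.
  apply Rle_lt_trans with 0; [|exact He].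
  apply c0_norm_lub; intros n; right.
  exact (eq_trans (f_equal norm (minus_eq_zero (x n))) norm_zero).
- intros x y e; now rewrite c0_norm_minus_sym.
- intros x y z e1 e2 H1 H2.
  replace (minus z x) with (plus (minus y x) (minus z y)).
  + eapply Rle_lt_trans; [apply c0_norm_triangle | lra].
  + rewrite plus_comm; symmetry; apply (minus_trans y).
Defined.

Canonical c0_UniformSpace :=
  UniformSpace.Pack (null_seq V) c0_UniformSpace_mixin (null_seq V).

Canonical c0_NormedModuleAux :=
  NormedModuleAux.Pack K (null_seq V)
    (NormedModuleAux.Class K _ (ModuleSpace.class K c0_ModuleSpace)
       c0_UniformSpace_mixin)
    (null_seq V).

Definition c0_NormedModule_mixin : NormedModule.mixin_of K c0_NormedModuleAux.
Proof.
apply (NormedModule.Mixin K c0_NormedModuleAux c0_norm 1).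
- exact c0_norm_triangle.
- exact c0_norm_scal.
- intros x y e H; exact H.
- intros x y e H; rewrite Rmult_1_l; exact H.
- exact c0_norm_eq_zero.
Defined.

Canonical c0_NormedModule :=
  NormedModule.Pack K (null_seq V)
    (NormedModule.Class K _ (NormedModuleAux.class K c0_NormedModuleAux)
       c0_NormedModule_mixin)
    (null_seq V).

Lemma c0_cauchy_lim (F : (null_seq V -> Prop) -> Prop) :
  ProperFilter F -> cauchy F ->
  exists l : null_seq V, forall eps : posreal, F (ball l eps).
Proof.
intros FF FC.
set (Fn := fun n => filtermap (fun x : null_seq V => x n) F).
assert (FnP : forall n, ProperFilter (Fn n)).
{ intros n; apply filtermap_proper_filter, FF. }
assert (FnC : forall n, cauchy (Fn n)).
{ intros n eps; destruct (FC eps) as [x Hx]; exists (x n).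
  unfold Fn, filtermap; eapply filter_imp; [|exact Hx].
  intros y Hy; apply (norm_compat1 (x n) (y n)).
  apply Rle_lt_trans with (2 := Hy), (c0_norm_ub (minus y x) n). }
set (l := fun n => lim (Fn n)).
assert (Hl : forall (eps : posreal) x, F (ball x eps) ->
               forall n, norm (minus (l n) (x n)) <= eps).
{ intros eps x Hx n; apply le_epsilon; intros d Hd.
  assert (Hf := @norm_factor_gt_0 K V).
  assert (Hd' : 0 < d / @norm_factor K V) by (apply Rdiv_lt_0_compat; assumption).
  generalize (complete_cauchy (Fn n) (FnP n) (FnC n) (mkposreal _ Hd')).
  intros Hy; unfold Fn, filtermap in Hy.
  destruct (filter_ex (F := F) _ (filter_and _ _ Hx Hy)) as [y [H1 H2]].
  apply ball_sym, (norm_compat2 (y n) (l n)) in H2; simpl in H2.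
  replace (minus (l n) (x n))
    with (plus (minus (l n) (y n)) (minus (y n) (x n)))
    by (symmetry; apply (minus_trans (y n))).
  eapply Rle_trans; [apply (norm_triangle (minus (l n) (y n)))|].
  assert (H3 := Rle_lt_trans _ _ _ (c0_norm_ub (minus y x) n) H1).
  replace (@norm_factor K V * (d / @norm_factor K V)) with d in H2 by (field; lra).
  rewrite (Rplus_comm eps d).
  apply Rplus_le_compat; apply Rlt_le; [exact H2 | exact H3]. }
assert (l0 : filterlim l eventually (locally (zero : V))).
{ apply null_limP; intros eps.
  destruct (FC (pos_div_2 eps)) as [x Hx].
  destruct (proj1 (null_limP x) (null_lim x) (pos_div_2 eps)) as [N HN].
  exists N; intros n Hn; specialize (HN n Hn); specialize (Hl _ x Hx n).
  simpl in HN, Hl.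
  replace (l n) with (plus (minus (l n) (x n)) (x n))
    by (unfold minus; now rewrite <- plus_assoc, plus_opp_l, plus_zero_r).
  eapply Rle_lt_trans; [apply (norm_triangle (minus (l n) (x n)))|].
  replace (pos eps) with (eps / 2 + eps / 2) by lra; apply Rplus_le_lt_compat; [exact Hl | exact HN]. }
exists (Null_seq l l0); intros eps.
destruct (FC (pos_div_2 (pos_div_2 eps))) as [x Hx].
eapply filter_imp; [|exact Hx].
intros y Hy.
apply ball_le with (pos_div_2 (pos_div_2 eps) + pos_div_2 eps);
  [destruct eps; simpl; lra|].
rewrite Rplus_comm; apply ball_triangle with x; [|exact Hy].
apply ball_sym.
change (c0_norm (minus (Null_seq l l0) x) < pos_div_2 eps).
apply Rle_lt_trans with (pos_div_2 (pos_div_2 eps));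
  [|destruct eps; simpl; lra].
apply c0_norm_lub; intros n; exact (Hl _ x Hx n).
Qed.

Definition c0_lim (F : (null_seq V -> Prop) -> Prop) : null_seq V :=
  epsilon (inhabits c0_zero) (fun l => forall eps : posreal, F (ball l eps)).

Definition c0_CompleteSpace_mixin : CompleteSpace.mixin_of c0_UniformSpace.
Proof.
apply (CompleteSpace.Mixin c0_UniformSpace c0_lim).
- intros F FF FC; unfold c0_lim; apply epsilon_spec.
  now apply c0_cauchy_lim.
- intros F1 F2 H12 H21.
  replace F2 with F1.
  + intros eps; apply ball_center.
  + apply functional_extensionality; intros P; apply propositional_extensionality.
    split; [apply H21 | apply H12].
Defined.

Canonical c0_CompleteNormedModule :=
  CompleteNormedModule.Pack K (null_seq V)
    (CompleteNormedModule.Class K _ (NormedModule.class K c0_NormedModule)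
       c0_CompleteSpace_mixin)
    (null_seq V).

End C0.

Definition c0 {K : AbsRing} (V : CompleteNormedModule K) : CompleteNormedModule K :=
  @c0_CompleteNormedModule K V.

Definition closure {T : UniformSpace} (A : T -> Prop) (x : T) : Prop :=
  forall eps : posreal, exists y, ball x eps y /\ A y.

Definition compact_set {T : UniformSpace} (A : T -> Prop) : Prop :=
  forall C : (T -> Prop) -> Prop,
    (forall U, C U -> open U) ->
    (forall x, A x -> exists U, C U /\ U x) ->
    exists l : list (T -> Prop),
      (forall U, In U l -> C U) /\
      (forall x, A x -> exists U, In U l /\ U x).

(* [is_linear] includes boundedness. *)
Definition is_compact_operator {K : AbsRing} {X Y : CompleteNormedModule K}
    (T : X -> Y) : Prop :=
  is_linear T /\
  compact_set (closure (fun y : Y => exists x : X, norm x <= 1 /\ y = T x)).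

Section MinimumModulus.

Context {K : AbsRing} {X Y : CompleteNormedModule K}.

Definition unit_sphere (x : X) : Prop := norm x = 1.

(* The value is [p_infty] exactly when the unit sphere is empty. *)
Definition min_modulus (T : X -> Y) : Rbar :=
  Glb_Rbar (fun r => exists x, unit_sphere x /\ r = norm (T x)).

Definition attains_min_modulus (T : X -> Y) : Prop :=
  exists x, unit_sphere x /\ Finite (norm (T x)) = min_modulus T.

End MinimumModulus.

Definition CPPm {K : AbsRing} (X Y : CompleteNormedModule K) : Prop :=
  forall T : X -> Y, is_linear T -> ~ attains_min_modulus T ->
    Rbar_lub (fun m => exists S : X -> Y, is_compact_operator S /\
                m = min_modulus (fun x => plus (T x) (S x)))
    = min_modulus T.

(* Main.v *)
(* Consider T x = (3/2 x_0 - s(x), 2 x_1, 2 x_2, ...) with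
   s(x) = sum_{n >= 1} 2^-n x_n. If |x| = 1 and |T x| <= 1, then |x_n| <= 1/2 for
   n >= 1, and |s(x)| < 1/2 because s does not attain its norm on c_0; so
   3/2 |x_0| < 3/2 and |x| < 1, a contradiction. Hence |T x| > 1 on the sphere,
   while (1, 1/2, ..., 1/2, 0, ...) shows that m(T) = 1. The rank-one
   perturbation x |-> (1/2 x_0 + s(x), 0, 0, ...) turns T into 2 Id. *)
Require Import Defs.
From Stdlib Require Import Reals.
From Coquelicot Require Import Coquelicot.
From Stdlib Require Import Lra Lia List Classical ClassicalEpsilon.

(** * Cancellation in abelian groups and limits of series *)

Lemma plus_opp_cancel {G : AbelianGroup} (a b : G) :
  plus (plus a (opp b)) b = a.
Proof.
rewrite <- plus_assoc.
eapply eq_trans; [apply f_equal, plus_opp_l | apply plus_zero_r].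
Qed.

Lemma plus_cancel_opp_r {G : AbelianGroup} (a b : G) :
  plus (plus a b) (opp b) = a.
Proof.
rewrite <- plus_assoc.
eapply eq_trans; [apply f_equal, plus_opp_r | apply plus_zero_r].
Qed.

Lemma plus_cancel_opp {G : AbelianGroup} (a b c : G) :
  plus (plus a (opp c)) (plus b c) = plus a b.
Proof.
rewrite (plus_comm b), plus_assoc.
exact (f_equal (fun d => plus d b) (plus_opp_cancel a c)).
Qed.

(** The norm is continuous, so the bound passes to the limit. The threshold [N] lets
    [norm_dyadic_sum_lt] start its induction where the tail becomes small. *)
Lemma is_series_norm_le {K : AbsRing} {V : NormedModule K} (a : nat -> V)
    (l : V) (c : R) (N : nat) :
  is_series a l -> (forall n, (N <= n)%nat -> norm (sum_n a n) <= c) ->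
  norm l <= c.
Proof.
intros Ha H.
apply (is_lim_seq_le_loc (fun n => norm (sum_n a n)) (fun _ => c) (norm l) c).
- exists N; exact H.
- exact (filterlim_comp _ _ _ _ _ _ _ _ Ha (filterlim_norm l)).
- apply is_lim_seq_const.
Qed.

Lemma is_series_unique_normed {K : AbsRing} {V : NormedModule K} (a : nat -> V)
    (l1 l2 : V) :
  is_series a l1 -> is_series a l2 -> l1 = l2.
Proof.
intros H1 H2; exact (filterlim_locally_unique _ _ _ H1 H2).
Qed.

Lemma is_series_finite_support {K : AbsRing} {V : NormedModule K}
    (a : nat -> V) (N : nat) :
  (forall n, (N < n)%nat -> a n = zero) -> is_series a (sum_n a N).
Proof.
intros Ha.
apply filterlim_ext_loc with (fun _ => sum_n a N); [|apply filterlim_const].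
exists N; intros n Hn; induction Hn as [|n Hn IH]; [reflexivity|].
now rewrite sum_Sn, <- IH, Ha, plus_zero_r by lia.
Qed.

(** * Operators on null sequences that act through the first coordinate, and their compactness *)

Section FirstCoordinate.

Context {K : AbsRing} {V : CompleteNormedModule K}.

Lemma null_seq_eventually (u : nat -> V) (x : null_seq V) (N : nat) :
  (forall n, (N <= n)%nat -> u n = x n) ->
  filterlim u eventually (locally (zero : V)).
Proof.
intros H; apply filterlim_ext_loc with (null_val x); [|apply null_lim].
exists N; intros n Hn; symmetry; now apply H.
Qed.

Definition replace_head (v : V) (x : null_seq V) (n : nat) : V :=
  match n with O => v | S _ => x n end.

Lemma replace_head_lim v x :
  filterlim (replace_head v x) eventually (locally (zero : V)).
Proof.
apply null_seq_eventually with x 1%nat; intros [|n] Hn; [lia | reflexivity].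
Qed.

Definition with_head (v : V) (x : null_seq V) : null_seq V :=
  Null_seq _ (replace_head_lim v x).

Lemma norm_with_head_le v (x : c0 V) :
  norm (with_head v x : c0 V) <= norm v + norm x.
Proof.
apply c0_norm_lub; intros [|n]; simpl.
- generalize (norm_ge_0 x); lra.
- generalize (norm_ge_0 v), (c0_norm_ub x (S n)).
  change (norm x) with (c0_norm x); lra.
Qed.

Lemma is_linear_with_head (f : c0 V -> V) (A : c0 V -> c0 V) :
  is_linear f -> is_linear A ->
  is_linear (fun x : c0 V => with_head (f x) (A x) : c0 V).
Proof.
intros [fP fS [Mf [Mf0 fM]]] [AP AS [MA [MA0 AM]]]; split.
- intros x y; apply null_seq_ext; intros [|n]; simpl; [apply fP|].
  now rewrite AP.
- intros k x; apply null_seq_ext; intros [|n]; simpl; [apply fS|].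
  now rewrite AS.
- exists (Mf + MA); split; [lra|]; intros x.
  eapply Rle_trans; [apply norm_with_head_le|].
  rewrite Rmult_plus_distr_r; now apply Rplus_le_compat.
Qed.

Lemma is_linear_coordinate (n : nat) : is_linear (fun x : c0 V => x n).
Proof.
split; [reflexivity | reflexivity |].
exists 1; split; [lra|]; intros x; rewrite Rmult_1_l; apply c0_norm_ub.
Qed.

(* Compactness of closed balls in the form given by Cousin's lemma. *)
Definition gauge_compact_balls : Prop :=
  forall (M : R) (delta : V -> posreal),
  exists l : list V, forall v, norm v <= M ->
  exists t, In t l /\ norm (minus v t) < delta t.

(** Coordinates past the first vanish on the image, and this survives uniform limits. An image point
    within 1 of [y] has norm at most [M], whence the radius [M + 1]. *)
Lemma closure_head_operator (f : c0 V -> V) (M : R) (y : c0 V) :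
  (forall x, norm (f x) <= M * norm x) -> 0 < M ->
  closure (fun y : c0 V => exists x : c0 V, norm x <= 1 /\
    y = with_head (f x) zero) y ->
  exists v, norm v <= M + 1 /\ y = with_head v zero.
Proof.
intros fM M0 Hy.
assert (Hn : forall n, y (S n) = zero).
{ intros n; apply (norm_eq_zero (y (S n))), Rle_antisym; [|apply norm_ge_0].
  apply le_epsilon; intros e He.
  destruct (Hy (mkposreal e He)) as [z [Hz [x [_ ->]]]].
  apply Rlt_le in Hz; simpl in Hz.
  rewrite c0_norm_minus_sym in Hz.
  apply (Rle_trans _ _ _ (c0_norm_ub _ (S n))) in Hz; simpl in Hz.
  change (norm (minus (y (S n)) zero) <= e) in Hz.
  rewrite minus_zero_r in Hz; lra. }
exists (y 0%nat); split.
- destruct (Hy (mkposreal 1 Rlt_0_1)) as [z [Hz [x [Hx ->]]]].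
  apply Rlt_le in Hz; simpl in Hz.
  rewrite c0_norm_minus_sym in Hz.
  apply (Rle_trans _ _ _ (c0_norm_ub _ 0%nat)) in Hz; simpl in Hz.
  change (norm (minus (y 0%nat) (f x)) <= 1) in Hz.
  assert (Hsplit : norm (y 0%nat) <= norm (minus (y 0%nat) (f x)) + norm (f x)).
  { replace (y 0%nat) with (plus (minus (y 0%nat) (f x)) (f x)) at 1
      by apply (plus_opp_cancel (G := V)).
    apply (norm_triangle (V := V)). }
  generalize (fM x), (Rmult_le_compat_l M _ _ (Rlt_le _ _ M0) Hx); lra.
- apply null_seq_ext; intros [|n]; [reflexivity | apply Hn].
Qed.

Lemma norm_minus_with_head_zero (v w : V) :
  c0_norm (minus (with_head v zero) (with_head w zero)) <= norm (minus v w).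
Proof.
apply c0_norm_lub; intros [|n]; [apply Rle_refl|].
eapply Rle_trans; [right | apply norm_ge_0].
exact (eq_trans (f_equal norm (minus_eq_zero (zero : V))) norm_zero).
Qed.

(** By [closure_head_operator] the closure sits in a copy of a ball of [V]. Each [t] receives a
    radius whose ball either maps into one member of the cover or misses the closure; gauge
    compactness then leaves finitely many [t]. *)
Lemma compact_head_operator (f : c0 V -> V) :
  gauge_compact_balls -> is_linear f ->
  is_compact_operator (fun x : c0 V => with_head (f x) zero : c0 V).
Proof.
intros HV Hf; split.
{ apply (is_linear_with_head f (fun _ => zero) Hf).
  exact (is_linear_zero (U := c0 V) (V := c0 V)). }
destruct (linear_norm f Hf) as [M [M0 fM]].
intros C Copen Ccover.
set (A := closure _) in *.
assert (Hdelta : forall t : V, exists eps : posreal,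
  (exists U, C U /\ forall v, norm (minus v t) < eps -> U (with_head v zero)) \/
  (forall v, norm (minus v t) < eps -> ~ A (with_head v zero))).
{ intros t; destruct (classic (A (with_head t zero))) as [At | nAt].
  - destruct (Ccover _ At) as [U [CU Ut]].
    destruct (Copen U CU _ Ut) as [eps Heps].
    exists eps; left; exists U; split; [exact CU|]; intros v Hv; apply Heps.
    exact (Rle_lt_trans _ _ _ (norm_minus_with_head_zero v t) Hv).
  - apply not_all_ex_not in nAt; destruct nAt as [eps Heps].
    (* Half of [eps] pays for the distance from [v] to [t], the other half for approximating [v] by
       the image. *)
    exists (pos_div_2 eps); right; intros v Hv Av; apply Heps.
    destruct (Av (pos_div_2 eps)) as [y [Hy Iy]].
    exists y; split; [|exact Iy].
    rewrite <- (Rplus_half_diag eps); apply ball_triangle with (with_head v zero);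
      [|exact Hy].
    exact (Rle_lt_trans _ _ _ (norm_minus_with_head_zero v t) Hv). }
set (delta t := proj1_sig (constructive_indefinite_description _ (Hdelta t))).
assert (Hd : forall t,
  (exists U, C U /\
     forall v, norm (minus v t) < delta t -> U (with_head v zero)) \/
  (forall v, norm (minus v t) < delta t -> ~ A (with_head v zero))).
{ intros t; exact (proj2_sig (constructive_indefinite_description _ (Hdelta t))). }
destruct (HV (M + 1) delta) as [l Hl].
assert (Hsub : exists l' : list (c0 V -> Prop),
  (forall U, In U l' -> C U) /\
  forall t v, In t l -> norm (minus v t) < delta t -> A (with_head v zero) ->
  exists U, In U l' /\ U (with_head v zero)).
(* [Hl] concerns the whole list and would not pass to its tail. Each tag contributes at most one
   member of the cover. *)
{ clear Hl; induction l as [|t l [l' [H1 H2]]].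
  - exists nil; split; [intros U []|]; intros t v [].
  - destruct (Hd t) as [[U [CU HU]] | HN].
    + exists (U :: l'); split; [intros W [<- | HW]; auto|].
      intros s v [<- | Hs] Hv Av.
      * exists U; split; [left; reflexivity | now apply HU].
      * destruct (H2 s v Hs Hv Av) as [W [HW Wv]]; exists W; split; [now right|].
        exact Wv.
    + exists l'; split; [exact H1|].
      intros s v [<- | Hs] Hv Av; [elim (HN v Hv Av) | now apply (H2 s)]. }
destruct Hsub as [l' [H1 H2]]; exists l'; split; [exact H1|].
intros y Hy.
destruct (closure_head_operator f M y fM M0 Hy) as [v [Hv ->]].
destruct (Hl v Hv) as [t [Ht Hvt]].
now apply (H2 t v).
Qed.

End FirstCoordinate.

(** * Real scalars inside [K] *)

(** Covers the real and complex fields at once. An [AbsRing] may be noncommutative with a merely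
    submultiplicative [abs], so commutation and isometry are demanded of the real scalars. *)
Record real_scalars {K : AbsRing} (j : R -> K) : Prop := {
  real_plus : forall r s, j (r + s) = plus (j r) (j s);
  real_mult : forall r s, j (r * s) = mult (j r) (j s);
  real_one : j 1 = one;
  real_abs : forall r, abs (j r) = Rabs r;
  real_comm : forall r k, mult (j r) k = mult k (j r) }.

Section Counterexample.

Context {K : AbsRing} {V : CompleteNormedModule K} {j : R -> K}.
Hypothesis Hj : real_scalars j.

(** [norm_scal] gives only an inequality; for nonzero [r], applying it to [/ r] yields the reverse
    one. *)
Lemma norm_scal_real {W : NormedModule K} (r : R) (v : W) :
  norm (scal (j r) v) = Rabs r * norm v.
Proof.
assert (H : forall s (w : W), norm (scal (j s) w) <= Rabs s * norm w).
{ intros s w; rewrite <- (real_abs j Hj s); apply norm_scal. }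
apply Rle_antisym; [apply H|].
destruct (Req_dec r 0) as [-> | Hr].
{ rewrite Rabs_R0, Rmult_0_l; apply norm_ge_0. }
apply Rmult_le_reg_l with (Rabs (/ r)).
{ now apply Rabs_pos_lt, Rinv_neq_0_compat. }
rewrite <- Rmult_assoc, <- Rabs_mult, Rinv_l, Rabs_R1, Rmult_1_l by exact Hr.
eapply Rle_trans; [|apply H].
right; f_equal; rewrite scal_assoc, <- (real_mult j Hj), Rinv_l by exact Hr.
now rewrite (real_one j Hj), scal_one.
Qed.

(* Rewriting in V needs this copy: its module structure is reached by another
   coercion path than in the previous lemma, equal only up to conversion. *)
Lemma norm_scal_realV (r : R) (v : V) : norm (scal (j r) v) = Rabs r * norm v.
Proof. exact (norm_scal_real r v). Qed.

Lemma scal_real_comm {W : ModuleSpace K} (r : R) (k : K) (v : W) :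
  scal (j r) (scal k v) = scal k (scal (j r) v).
Proof.
now rewrite !scal_assoc, (real_comm j Hj).
Qed.

Lemma is_linear_scal_real {W : NormedModule K} (r : R) :
  is_linear (fun v : W => scal (j r) v).
Proof.
split.
- intros x y; apply (scal_distr_l (V := W)).
- intros k x; apply scal_real_comm.
(* [is_linear] asks for a positive bound; the [+ 1] covers [r = 0]. *)
- exists (Rabs r + 1); split; [generalize (Rabs_pos r); lra|].
  intros x; rewrite norm_scal_real.
  generalize (norm_ge_0 x); lra.
Qed.

(** * The functional [s], as a series in [V] *)

(** The index is shifted: the series starts at coordinate 1 with weight [1/2], so coordinate 0 stays
    out and the weights add up to 1. *)
Definition dyadic_term (x : null_seq V) (n : nat) : V :=
  scal (j ((/ 2) ^ S n)) (x (S n)).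

Lemma norm_dyadic_term (x : null_seq V) (n : nat) :
  norm (dyadic_term x n) = (/ 2) ^ S n * norm (x (S n)).
Proof.
unfold dyadic_term; rewrite norm_scal_realV.
now rewrite Rabs_pos_eq by (apply pow_le; lra).
Qed.

(** The first [n + 1] weights add up to [1 - 2^-(n+1)]. *)
Lemma sum_norm_dyadic_le (x : null_seq V) (B : R) (n : nat) :
  (forall k, norm (x (S k)) <= B) ->
  norm (sum_n (dyadic_term x) n) <= B * (1 - (/ 2) ^ S n).
Proof.
intros HB; induction n as [|n IH].
- rewrite sum_O, norm_dyadic_term; specialize (HB 0%nat); simpl; lra.
- rewrite sum_Sn; eapply Rle_trans; [apply (norm_triangle (V := V))|].
  rewrite norm_dyadic_term.
  assert (P : 0 < (/ 2) ^ S n) by (apply pow_lt; lra).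
  generalize (Rmult_le_compat_l _ _ _ (Rlt_le _ _ P) (HB (S n))).
  change ((/ 2) ^ S (S n)) with (/ 2 * (/ 2) ^ S n); lra.
Qed.

(** Comparison with a geometric series, by completeness of [V]. *)
Lemma ex_series_dyadic (x : null_seq V) : exists l, is_series (dyadic_term x) l.
Proof.
apply (ex_series_le _ (fun n => scal (c0_norm x / 2) ((/ 2) ^ n))).
- intros n; rewrite norm_dyadic_term.
  assert (P : 0 < (/ 2) ^ n) by (apply pow_lt; lra).
  generalize (Rmult_le_compat_l _ _ _ (Rlt_le _ _ P) (c0_norm_ub x (S n))).
  change (scal (c0_norm x / 2) ((/ 2) ^ n)) with (c0_norm x / 2 * (/ 2) ^ n).
  simpl; lra.
- apply (ex_series_scal (c0_norm x / 2) (fun n => (/ 2) ^ n)).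
  apply ex_series_geom; rewrite Rabs_pos_eq; lra.
Qed.

Definition dyadic_sum (x : null_seq V) : V :=
  epsilon (inhabits zero) (is_series (dyadic_term x)).

Lemma is_series_dyadic_sum (x : null_seq V) :
  is_series (dyadic_term x) (dyadic_sum x).
Proof.
unfold dyadic_sum; apply epsilon_spec, ex_series_dyadic.
Qed.

Lemma dyadic_sum_unique (x : null_seq V) (l : V) :
  is_series (dyadic_term x) l -> dyadic_sum x = l.
Proof.
apply is_series_unique_normed, is_series_dyadic_sum.
Qed.

Lemma norm_dyadic_sum_le (x : null_seq V) (B : R) :
  (forall k, norm (x (S k)) <= B) -> norm (dyadic_sum x) <= B.
Proof.
intros HB; apply (is_series_norm_le _ _ _ 0 (is_series_dyadic_sum x)).
intros n _; eapply Rle_trans; [apply sum_norm_dyadic_le, HB|].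
assert (P : 0 < (/ 2) ^ S n) by (apply pow_lt; lra).
(* [B] is nonnegative because it bounds a norm. *)
generalize (Rle_trans _ _ _ (norm_ge_0 _) (HB 0%nat)); intros HB0.
generalize (Rmult_le_pos _ _ HB0 (Rlt_le _ _ P)); lra.
Qed.

(* Strict because a null sequence cannot have all its terms of norm near B. *)
Lemma norm_dyadic_sum_lt (x : null_seq V) (B : R) :
  0 < B -> (forall k, norm (x (S k)) <= B) -> norm (dyadic_sum x) < B.
Proof.
intros B0 HB.
assert (B2 : 0 < B / 2) by lra.
destruct (proj1 (null_limP x) (null_lim x) (mkposreal _ B2)) as [N HN].
assert (P : 0 < (/ 2) ^ S N) by (apply pow_lt; lra).
(* Terms up to index [N] are charged [B] times their weight; the later ones, of norm at most
   [B / 2], share the remaining weight [2^-(N+1)]. *)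
apply Rle_lt_trans with (B * (1 - (/ 2) ^ S N) + B / 2 * (/ 2) ^ S N);
  [|generalize (Rmult_lt_0_compat _ _ B0 P); lra].
apply (is_series_norm_le _ _ _ N (is_series_dyadic_sum x)).
intros n Hn.
(* The induction needs the exact weight used between [N] and [n], not the whole tail. *)
apply Rle_trans with
  (B * (1 - (/ 2) ^ S N) + B / 2 * ((/ 2) ^ S N - (/ 2) ^ S n)).
2:{ assert (Q : 0 < (/ 2) ^ S n) by (apply pow_lt; lra).
    generalize (Rmult_lt_0_compat _ _ B0 Q); lra. }
induction Hn as [|n Hn IH].
- eapply Rle_trans; [apply sum_norm_dyadic_le, HB | lra].
- rewrite sum_Sn; eapply Rle_trans; [apply (norm_triangle (V := V))|].
  rewrite norm_dyadic_term.
  assert (Q : 0 < (/ 2) ^ S n) by (apply pow_lt; lra).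
  assert (H : norm (x (S (S n))) <= B / 2) by (apply Rlt_le, HN; lia).
  generalize (Rmult_le_compat_l _ _ _ (Rlt_le _ _ Q) H).
  change ((/ 2) ^ S (S n)) with (/ 2 * (/ 2) ^ S n); lra.
Qed.

(** The termwise identities pass to the limit by uniqueness; [scal_real_comm] moves scalars of [K]
    past the weights. *)
Lemma is_linear_dyadic_sum : is_linear (fun x : c0 V => dyadic_sum x).
Proof.
split.
- intros x y; apply dyadic_sum_unique.
  eapply filterlim_ext; [|apply (is_series_plus _ _ _ _
    (is_series_dyadic_sum x) (is_series_dyadic_sum y))].
  intros n; apply sum_n_ext; intros k; symmetry.
  apply (scal_distr_l (V := V)).
- intros k x; apply dyadic_sum_unique.
  eapply filterlim_ext; [|apply (is_series_scal k _ _
    (is_series_dyadic_sum x))].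
  intros n; apply sum_n_ext; intros m; symmetry; apply scal_real_comm.
- exists 1; split; [lra|]; intros x; rewrite Rmult_1_l.
  apply norm_dyadic_sum_le; intros n; apply c0_norm_ub.
Qed.

(** * The operator, its rank-one correction, and its minimum modulus *)

Definition skew_head (x : c0 V) : V :=
  plus (scal (j (3 / 2)) (x 0%nat)) (opp (dyadic_sum x)).

Definition skew_double (x : c0 V) : c0 V :=
  with_head (skew_head x) (scal (j 2) x).

Definition head_correction (x : c0 V) : V :=
  plus (scal (j (1 / 2)) (x 0%nat)) (dyadic_sum x).

Lemma is_linear_add (f g : c0 V -> V) :
  is_linear f -> is_linear g -> is_linear (fun x => plus (f x) (g x)).
Proof.
intros Hf Hg.
exact (is_linear_comp _ _ (is_linear_prod f g Hf Hg) is_linear_plus).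
Qed.

Lemma is_linear_scal_head (r : R) :
  is_linear (fun x : c0 V => scal (j r) (x 0%nat)).
Proof.
exact (is_linear_comp _ _ (is_linear_coordinate 0) (is_linear_scal_real r)).
Qed.

Lemma is_linear_skew_double : is_linear skew_double.
Proof.
apply (is_linear_with_head skew_head (fun x => scal (j 2) x)).
- apply (is_linear_add (fun x => scal (j _) (x 0%nat)));
    [apply is_linear_scal_head|].
  exact (is_linear_comp _ _ is_linear_dyadic_sum is_linear_opp).
- apply (is_linear_scal_real (W := c0 V)).
Qed.

Lemma is_linear_head_correction : is_linear head_correction.
Proof.
apply (is_linear_add (fun x => scal (j _) (x 0%nat)));
  [apply is_linear_scal_head | apply is_linear_dyadic_sum].
Qed.

(** In the first coordinate the dyadic sums cancel and [3/2 + 1/2 = 2]. *)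
Lemma skew_double_plus_correction (x : c0 V) :
  plus (skew_double x) (with_head (head_correction x) zero) = scal (j 2) x.
Proof.
apply null_seq_ext; intros [|n]; simpl.
- change (plus (skew_head x) (head_correction x) = scal (j 2) (x 0%nat)).
  unfold skew_head, head_correction.
  eapply eq_trans; [apply (plus_cancel_opp (G := V))|].
  eapply eq_trans; [symmetry; apply (scal_distr_r (V := V))|].
  rewrite <- (real_plus j Hj); f_equal; f_equal; lra.
- apply (plus_zero_r (G := V)).
Qed.

Lemma norm_skew_double_gt (x : c0 V) : norm x = 1 -> 1 < norm (skew_double x).
Proof.
intros Hx; apply Rnot_le_lt; intros HT.
assert (HS : forall n, norm (x (S n)) <= / 2).
{ intros n; generalize (Rle_trans _ _ _ (c0_norm_ub (skew_double x) (S n)) HT).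
  change (skew_double x (S n)) with (scal (j 2) (x (S n))).
  rewrite norm_scal_realV, Rabs_pos_eq; lra. }
assert (H0 : norm (skew_head x) <= 1).
{ exact (Rle_trans _ _ _ (c0_norm_ub (skew_double x) 0%nat) HT). }
assert (Hd : norm (dyadic_sum x) < / 2).
{ apply norm_dyadic_sum_lt; [lra | exact HS]. }
assert (Hh : 3 / 2 * norm (x 0%nat) <= norm (skew_head x) + norm (dyadic_sum x)).
{ rewrite <- (Rabs_pos_eq (3 / 2)), <- norm_scal_realV by lra.
  replace (scal (j (3 / 2)) (x 0%nat)) with (plus (skew_head x) (dyadic_sum x)).
  - apply (norm_triangle (V := V)).
  - apply (plus_opp_cancel (G := V)). }
apply (Rlt_irrefl 1); rewrite <- Hx at 1.
(* Strict bounds on the coordinates alone would not pass to the supremum, hence one common maximum.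
   It is below 1 since [Hh] gives [3/2 |x_0| < 1 + 1/2]. *)
apply Rle_lt_trans with (Rmax (norm (x 0%nat)) (/ 2));
  [|apply Rmax_lub_lt; lra].
apply c0_norm_lub; intros [|n]; [apply Rmax_l|].
eapply Rle_trans; [apply HS | apply Rmax_r].
Qed.

(* (v, v/2, ..., v/2, 0, 0, ...), with N + 1 entries v/2. *)
Definition flat_fun (v : V) (N n : nat) : V :=
  match n with
  | O => v
  | S m => if Nat.leb m N then scal (j (/ 2)) v else zero
  end.

Lemma flat_fun_lim v N :
  filterlim (flat_fun v N) eventually (locally (zero : V)).
Proof.
apply null_seq_eventually with (zero : null_seq V) (S (S N)).
intros [|n] Hn; [lia|]; simpl.
destruct (Nat.leb_spec n N); [lia | reflexivity].
Qed.

Definition flat (v : V) (N : nat) : c0 V := Null_seq _ (flat_fun_lim v N).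

Lemma norm_flat v N : norm v = 1 -> norm (flat v N) = 1.
Proof.
intros Hv; apply Rle_antisym.
- apply c0_norm_lub; intros [|n]; [right; exact Hv|]; simpl.
  destruct (Nat.leb n N).
  + rewrite norm_scal_realV, Rabs_pos_eq; lra.
  + replace (norm _) with 0 by (symmetry; apply (norm_zero (V := V))); lra.
- rewrite <- Hv at 1; exact (c0_norm_ub (flat v N) 0%nat).
Qed.

(** The entries [v/2] occupy terms 0 to [N], of total weight [1 - 2^-(N+1)]; the series is zero
    afterwards. *)
Lemma dyadic_sum_flat v N :
  dyadic_sum (flat v N) = scal (j (/ 2 * (1 - (/ 2) ^ S N))) v.
Proof.
assert (H : forall n, (n <= N)%nat ->
  sum_n (dyadic_term (flat v N)) n = scal (j (/ 2 * (1 - (/ 2) ^ S n))) v).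
{ assert (Ht : forall n, (n <= N)%nat ->
    dyadic_term (flat v N) n = scal (j ((/ 2) ^ S n * / 2)) v).
  { intros n Hn; unfold dyadic_term; simpl.
    destruct (Nat.leb_spec n N); [|lia].
    now rewrite scal_assoc, <- (real_mult j Hj). }
  induction n as [|n IH]; intros Hn.
  - rewrite sum_O, Ht by exact Hn; f_equal; f_equal; simpl; lra.
  - rewrite sum_Sn, IH, Ht by lia.
    rewrite <- (scal_distr_r (V := V)), <- (real_plus j Hj).
    f_equal; f_equal; simpl; lra. }
rewrite <- H by lia; apply dyadic_sum_unique.
apply (is_series_finite_support (V := V)).
intros n Hn; unfold dyadic_term; simpl.
destruct (Nat.leb_spec n N); [lia|]; apply (scal_zero_r (V := V)).
Qed.

(** The head is [3/2 - 1/2 (1 - 2^-(N+1)) = 1 + 2^-(N+2)] times [v]; every other coordinate has norm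
    1 or 0. *)
Lemma norm_skew_double_flat_le v N :
  norm v = 1 -> norm (skew_double (flat v N)) <= 1 + (/ 2) ^ N.
Proof.
intros Hv.
assert (P : 0 < (/ 2) ^ N) by (apply pow_lt; lra).
apply c0_norm_lub; intros [|n].
- change (norm (skew_head (flat v N)) <= 1 + (/ 2) ^ N).
  unfold skew_head; rewrite dyadic_sum_flat.
  change (flat v N 0%nat) with v.
  replace (plus _ _) with (scal (j (1 + / 2 * (/ 2) ^ S N)) v).
  + rewrite norm_scal_realV, Hv, Rabs_pos_eq; simpl; lra.
  (* Splits [3/2] so that its second summand cancels the dyadic sum. *)
  + replace (3 / 2) with
      ((1 + / 2 * (/ 2) ^ S N) + / 2 * (1 - (/ 2) ^ S N)) by lra.
    rewrite (real_plus j Hj (1 + _)); symmetry.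
    eapply eq_trans; [|apply (plus_cancel_opp_r (G := V))].
    apply (f_equal (fun d => plus d _)), (scal_distr_r (V := V)).
- change (norm (scal (j 2) (flat v N (S n))) <= 1 + (/ 2) ^ N).
  rewrite norm_scal_realV, Rabs_pos_eq by lra; simpl.
  destruct (Nat.leb n N).
  + rewrite norm_scal_realV, Rabs_pos_eq; lra.
  + replace (norm _) with 0 by (symmetry; apply (norm_zero (V := V))); lra.
Qed.

(** This bound does two jobs: with [norm_skew_double_gt] it excludes attainment, and it caps the
    supremum that CPPm would equate with the minimum modulus. *)
Lemma min_modulus_skew_double_le (v : V) :
  norm v = 1 -> Rbar_le (min_modulus skew_double) 1.
Proof.
intros Hv.
destruct (Glb_Rbar_correct
  (fun r => exists x, unit_sphere x /\ r = norm (skew_double x))) as [Hlb _].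
fold (min_modulus skew_double) in Hlb.
assert (H : forall N, Rbar_le (min_modulus skew_double) (1 + (/ 2) ^ N)).
{ intros N.
  apply (Rbar_le_trans _ (norm (skew_double (flat v N)))).
  - apply Hlb; exists (flat v N); split; [now apply norm_flat | reflexivity].
  - now apply norm_skew_double_flat_le. }
(* The infimum lives in [Rbar]: at [p_infty] the bound for [N = 0] is already absurd, and at
   [m_infty] the goal is trivial. *)
destruct (min_modulus skew_double) as [m | |]; [|exact (H 0%nat)|exact I].
apply (is_lim_seq_le (fun _ => m) (fun N => 1 + (/ 2) ^ N) m 1 H).
- apply is_lim_seq_const.
- replace (Finite 1) with (Finite (1 + 0)) by (f_equal; lra).
  apply is_lim_seq_plus'; [apply is_lim_seq_const|].
  apply is_lim_seq_geom; rewrite Rabs_pos_eq; lra.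
Qed.

(** * Failure of CPPm over abstract scalars *)

Lemma not_CPPm_c0 (v : V) :
  norm v = 1 -> @gauge_compact_balls K V -> ~ CPPm (c0 V) (c0 V).
Proof.
intros Hv HV HC.
assert (Hle := min_modulus_skew_double_le v Hv).
specialize (HC skew_double is_linear_skew_double).
assert (Hna : ~ attains_min_modulus skew_double).
{ intros [x [Hx Ex]]; rewrite <- Ex in Hle; simpl in Hle.
  generalize (norm_skew_double_gt x Hx); lra. }
(* CPPm turns the bound on the minimum modulus into a bound by 1 on the supremum over all compact
   perturbations. *)
specialize (HC Hna); rewrite <- HC in Hle.
unfold Rbar_lub in Hle.
destruct (Rbar_ex_lub _) as [l [Hub Hl]]; simpl in Hle.
set (S0 := fun x : c0 V => with_head (head_correction x) zero : c0 V).
assert (H2 : Rbar_le 2 (min_modulus (fun x => plus (skew_double x) (S0 x)))).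
{ apply (proj2 (Glb_Rbar_correct _)); intros r [x [Hx ->]].
  unfold S0; rewrite skew_double_plus_correction.
  rewrite (norm_scal_real (W := c0 V)), Rabs_pos_eq by lra.
  rewrite Hx; simpl; lra. }
assert (H21 : Rbar_le 2 1).
{ eapply Rbar_le_trans; [exact H2|]; eapply Rbar_le_trans; [|exact Hle].
  apply Hub; exists S0; split; [|reflexivity].
  apply compact_head_operator; [exact HV | apply is_linear_head_correction]. }
simpl in H21; lra.
Qed.

End Counterexample.

(** * The real and complex cases *)

(** [compactness_list] is Cousin's lemma for boxes, under a double negation that [NNPP] removes;
    reals are encoded as tuples of length 1. *)
Lemma gauge_compact_balls_R : @gauge_compact_balls _ R_CompleteNormedModule.
Proof.
intros M delta; apply NNPP; intros H.
apply (compactness_list 1 (- M, tt) (M, tt) (fun t => delta (fst t))).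
intros [l Hl]; apply H; exists (map fst l); intros v Hv.
destruct (Hl (v, tt)) as [[t []] [Ht [_ [Hvt _]]]].
{ split; [apply Rabs_le_between, Hv | exact I]. }
exists t; split; [exact (in_map fst l _ Ht) | exact Hvt].
Qed.

(** The disc lies in the square of half-side [M], a box of dimension 2. The gauge is divided by
    [sqrt 2] because the modulus is at most [sqrt 2] times the larger of the absolute values of the
    real and imaginary parts. *)
Lemma gauge_compact_balls_C : @gauge_compact_balls _ C_CompleteNormedModule.
Proof.
intros M delta; apply NNPP; intros H.
assert (Hs : 0 < sqrt 2) by (apply sqrt_lt_R0; lra).
assert (Hd : forall t : C, 0 < delta t / sqrt 2).
{ intros t; apply Rdiv_lt_0_compat; [apply cond_pos | exact Hs]. }
apply (compactness_list 2 (- M, (- M, tt)) (M, (M, tt))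
  (fun t => mkposreal _ (Hd (fst t, fst (snd t))))).
intros [l Hl]; apply H.
exists (map (fun t : Compactness.Tn 2 R => (fst t, fst (snd t)) : C) l).
intros [a b] Hv.
assert (Hab := Rle_trans _ _ _ (Rmax_Cmod (a, b)) Hv); simpl in Hab.
destruct (Hl (a, (b, tt))) as [[t1 [t2 []]] [Ht [_ [Hvt1 [Hvt2 _]]]]].
{ split; [|split; [|exact I]]; apply Rabs_le_between;
    (eapply Rle_trans; [|exact Hab]); [apply Rmax_l | apply Rmax_r]. }
exists (t1, t2); split.
{ exact (in_map (fun t : Compactness.Tn 2 R => (fst t, fst (snd t)) : C) l _ Ht). }
eapply Rle_lt_trans; [apply Cmod_2Rmax|].
apply Rlt_le_trans with (sqrt 2 * (delta (t1, t2) / sqrt 2)).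
- apply Rmult_lt_compat_l; [exact Hs|].
  apply Rmax_lub_lt; [exact Hvt1 | exact Hvt2].
- right; field; lra.
Qed.

Lemma real_scalars_R : @real_scalars R_AbsRing (fun r => r).
Proof.
split; try reflexivity; intros r k; apply Rmult_comm.
Qed.

Lemma real_scalars_C : @real_scalars C_AbsRing RtoC.
Proof.
split; intros.
- apply RtoC_plus.
- apply RtoC_mult.
- reflexivity.
- apply Cmod_R.
- apply Cmult_comm.
Qed.

Theorem theorem1p1 :
  ~ CPPm (c0 R_CompleteNormedModule) (c0 R_CompleteNormedModule) /\
  ~ CPPm (c0 C_CompleteNormedModule) (c0 C_CompleteNormedModule).
Proof.
split.
- apply (not_CPPm_c0 real_scalars_R (1 : R));
    [exact Rabs_R1 | exact gauge_compact_balls_R].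
- apply (not_CPPm_c0 real_scalars_C (RtoC 1));
    [exact Cmod_1 | exact gauge_compact_balls_C].
Qed.
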